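(* For every integer $n\ge 0$, partitions of the set $[n]=\{1,2,\ldots,n\}$ are in one-to-one correspondence with the permutations in $\mathcal{S}_n$ that avoid the pattern $(a\text{-}bc)$. Hence $|\mathcal{S}_n(a\text{-}bc)|=B_n$, where $B_n$ is the $n$th Bell number, i.e. the number of partitions of $[n]$.
   Context: $\mathcal{S}_n$ is the set of permutations of $[n]$, written as words $\pi=a_1a_2\cdots a_n$ (with $\mathcal{S}_0$ consisting of the empty word only). A (generalised) pattern is a word in distinct letters of the ordered alphabet $a<b<c<\cdots$ in which two adjacent letters may or may not be separated by a dash. A $p$-subword of $\pi$ is a subword $a_{i_1}a_{i_2}\cdots a_{i_k}$ ($i_1<i_2<\cdots<i_k$) whose letters are in the same relative order as the letters of $p$, and such that $i_{j+1}=i_j+1$ whenever the $j$th and $(j+1)$st letters of $p$ are not separated by a dash. For example, an $(a\text{-}bc)$-subword of $\pi$ is a subword $a_ia_ja_{j+1}$ with $i<j$ and $a_i<a_j<a_{j+1}$. A permutation avoids $p$ if it has no $p$-subword; $\mathcal{S}_n(p)$ is the set of permutations in $\mathcal{S}_n$ avoiding $p$. A partition of a set is a family of pairwise disjoint non-empty subsets (blocks) whose union is the set. *)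

(* Defs.v *)
From mathcomp Require Import all_boot all_fingroup.

Set Implicit Arguments.
Unset Strict Implicit.
Unset Printing Implicit Defensive.

(* The letters a < b < c < ... are coded 0 < 1 < 2 < ...; the j-th entry of
   [gp_dashes] tells whether letters j and j.+1 (counted from 0) are separated
   by a dash. *)
Record gpattern := GPattern {
  gp_word : seq nat;
  gp_dashes : seq bool;
  gp_word_uniq : uniq gp_word;
  gp_dashes_size : size gp_dashes = (size gp_word).-1
}.

Definition gp_length (p : gpattern) : nat := size (gp_word p).

(* [n] is represented by 'I_n, that is shifted to {0, ..., n-1}, and a
   permutation s by its word s 0, s 1, ..., s (n-1). As the letters of s are
   distinct, a subword is given by the tuple t of its positions. *)
Definition is_psubword (p : gpattern) (n : nat) (s : 'S_n)
    (t : (gp_length p).-tuple 'I_n) : bool :=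
  [&& [forall j : 'I_(gp_length p), forall k : 'I_(gp_length p),
        (j < k) ==> (tnth t j < tnth t k)],
      [forall j : 'I_(gp_length p), forall k : 'I_(gp_length p),
        (s (tnth t j) < s (tnth t k))
          == (nth 0 (gp_word p) j < nth 0 (gp_word p) k)]
    & [forall j : 'I_(gp_length p), forall k : 'I_(gp_length p),
        (k == j.+1 :> nat) && ~~ nth true (gp_dashes p) j
          ==> (tnth t k == (tnth t j).+1 :> nat)]].

Definition avoids (p : gpattern) (n : nat) (s : 'S_n) : bool :=
  ~~ [exists t : (gp_length p).-tuple 'I_n, is_psubword s t].

Definition avoiders (p : gpattern) (n : nat) : {set 'S_n} :=
  [set s : 'S_n | avoids p s].

Definition a_bc : gpattern :=
  @GPattern [:: 0; 1; 2] [:: true; false] isT erefl.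

Definition set_partitions (n : nat) : {set {set {set 'I_n}}} :=
  [set P : {set {set 'I_n}} | partition P [set: 'I_n]].

Definition Bell (n : nat) : nat := #|set_partitions n|.

(* Main.v *)
Require Import Defs.
From mathcomp Require Import all_boot all_fingroup.
From mathcomp Require Import zify.

Set Implicit Arguments.
Unset Strict Implicit.
Unset Printing Implicit Defensive.

(** A permutation avoids a-bc exactly when every ascent starts at a
    left-to-right minimum.  Cut the word of such a permutation before each
    left-to-right minimum: each factor consists of its least letter followed by
    its other letters in decreasing order, and the least letters of successive
    factors decrease.  The word can therefore be recovered from the partition
    of the letters into factors, and every partition arises in this way: write
    the minimum of each block first and its other elements in decreasing order,
    and list the blocks by decreasing minima.

    Both sides are compared with the set [block_minima n] of the maps f with
    f x <= x and f (f x) = f x; such a map sends each x to the least element of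
    its block, for the partition into the fibres of f
    ([card_block_minima_partitions]).  From a permutation, f is obtained by
    sending each letter to the least letter weakly to its left
    ([prefix_minima]).  From f, the word is obtained by sorting the letters
    according to the numerical key [reading_key f], which is the order described
    above.  An avoider has its letters sorted by the key of its own prefix
    minima ([avoider_sorted]), so that [prefix_minima] is injective on avoiders;
    sorting by the key of an arbitrary f yields an avoider
    ([sorted_avoids]) whose prefix minima are f ([sorted_prefix_minima]).  All the
    sets being finite, the equality of cardinals provides the bijection. *)

(** * The pattern a-bc *)

Lemma avoids_a_bcP n (s : 'S_n) :
  reflect (forall i j k : 'I_n, i < j -> k = j.+1 :> nat ->
             s i < s j -> s j < s k -> False)
          (avoids a_bc s).
Proof.
apply: (iffP idP) => [avs i j k ij kj sij sjk | avs].
  case/negP: avs; apply/existsP; exists [tuple i; j; k].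
  apply/and3P; split; apply/forallP => -[[|[|[|//]]] ?];
    apply/forallP => -[[|[|[|//]]] ?];
    rewrite !(tnth_nth i) //=; lia.
apply/negP => /existsP[t /and3P[inc rel adj]].
pose o k (lt_k : k < 3) : 'I_(gp_length a_bc) := Ordinal lt_k.
have inc01 : tnth t (@o 0 isT) < tnth t (@o 1 isT).
  exact: (implyP (forallP (forallP inc _) _)).
have rel01 : s (tnth t (@o 0 isT)) < s (tnth t (@o 1 isT)).
  by rewrite (eqP (forallP (forallP rel _) _)).
have rel12 : s (tnth t (@o 1 isT)) < s (tnth t (@o 2 isT)).
  by rewrite (eqP (forallP (forallP rel _) _)).
apply: (avs _ _ _ inc01 _ rel01 rel12); apply/eqP.
exact: (implyP (forallP (forallP adj (@o 1 isT)) (@o 2 isT))).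
Qed.

(** * Permutations and orders *)

Lemma perm_rank n (t : 'S_n) x : t x = #|[set y | t y < t x]| :> nat.
Proof.
have -> : [set y | t y < t x] = (t^-1)%g @: [set i : 'I_n | i < t x].
  apply/setP => y; rewrite -[y in RHS](permK t) mem_imset; last exact: perm_inj.
  by rewrite !inE.
rewrite card_imset; last exact: perm_inj.
rewrite -sum1dep_card (big_ord_narrow (ltnW (ltn_ord (t x)))).
by rewrite sum1_card card_ord.
Qed.

Lemma perm_eq_order n (t u : 'S_n) :
  (forall x y, (t x < t y) = (u x < u y)) -> t = u.
Proof.
move=> eq_tu; apply/permP => x; apply: val_inj => /=.
by rewrite [LHS]perm_rank [RHS]perm_rank; apply: eq_card => y; rewrite !inE eq_tu.
Qed.

Lemma perm_of_key n (key : 'I_n -> nat) : injective key ->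
  exists t : 'S_n, forall x y, (t x < t y) = (key x < key y).
Proof.
move=> key_inj; pose below x := [set y | key y < key x].
have below_mono x y : key x < key y -> #|below x| < #|below y|.
  move=> lt_xy; apply: proper_card; apply/properP; split.
    by apply/subsetP => z; rewrite !inE => /ltn_trans->.
  by exists x; rewrite !inE ?ltnn.
have below_lt x : #|below x| < n.
  rewrite -[X in _ < X]card_ord -cardsT; apply: proper_card.
  by apply/properP; split; [apply: subsetT | exists x; rewrite !inE ?ltnn].
have rank_inj : injective (fun x => Ordinal (below_lt x)).
  move=> x y [eq_xy]; apply: key_inj.
  by case: (ltngtP (key x) (key y)) => // /below_mono; rewrite eq_xy ltnn.
exists (perm rank_inj) => x y; rewrite !permE /=.
apply/idP/idP => [|/below_mono//]; rewrite !ltnNge; apply: contra.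
by rewrite leq_eqVlt => /predU1P[/key_inj-> // | /below_mono/ltnW].
Qed.

(** * Maps to block minima *)

(** A normal form for partitions that, unlike a family of blocks, can be
    evaluated at a letter: it is the choice of the minimum as representative of
    each block. *)
Definition block_minima n : {set {ffun 'I_n -> 'I_n}} :=
  [set f : {ffun 'I_n -> 'I_n} | [forall x, (f x <= x) && (f (f x) == f x)]].

Lemma block_minimaP n (f : {ffun 'I_n -> 'I_n}) :
  reflect ((forall x, f x <= x) /\ (forall x, f (f x) = f x))
          (f \in block_minima n).
Proof.
rewrite inE; apply: (iffP forallP) => [fP|[fle fK] x].
  by split=> x; case/andP: (fP x) => // _ /eqP.
by rewrite fle fK eqxx.
Qed.

Lemma mem_pblock_preim (n : nat) (f : 'I_n -> 'I_n) x y :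
  (y \in pblock (preim_partition f [set: 'I_n]) x) = (f x == f y).
Proof.
rewrite pblock_equivalence_partition ?inE //.
by move=> ? ? ? _ _ _ /=; split=> // /eqP->.
Qed.

(** Two such maps with the same fibres agree: f' x lies in the fibre of f
    through x, so that f x = f (f' x) <= f' x, and symmetrically. *)
Lemma preim_block_minima_inj n :
  {in block_minima n &,
    injective (fun f : {ffun 'I_n -> 'I_n} => preim_partition f [set: 'I_n])}.
Proof.
have half (f g : {ffun 'I_n -> 'I_n}) :
    f \in block_minima n -> g \in block_minima n ->
    preim_partition f [set: 'I_n] = preim_partition g [set: 'I_n] ->
    forall x, f x <= g x.
  move=> /block_minimaP[fle _] /block_minimaP[_ gK] eq_fg x.
  have : g x \in pblock (preim_partition g [set: 'I_n]) x.
    by rewrite mem_pblock_preim gK.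
  by rewrite -eq_fg mem_pblock_preim => /eqP->.
move=> f g fB gB eq_fg; apply/ffunP => x; apply/val_inj/anti_leq.
by rewrite !half.
Qed.

Lemma partition_block_minima n (P : {set {set 'I_n}}) :
  partition P [set: 'I_n] ->
  exists2 f, f \in block_minima n & P = preim_partition f [set: 'I_n].
Proof.
move=> partP; have [/eqP covP trivP _] := and3P partP.
have in_block x : x \in pblock P x by rewrite mem_pblock covP inE.
pose f := [ffun x : 'I_n => [arg min_(y < x in pblock P x) y]].
have fP x : f x \in pblock P x /\ forall y, y \in pblock P x -> f x <= y.
  by rewrite ffunE; case: arg_minnP.
have block_f x : pblock P (f x) = pblock P x.
  by apply/same_pblock; case: (fP x).
have f_block x y : pblock P x = pblock P y -> f x = f y.
  move=> eq_xy; apply/val_inj/anti_leq.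
  have [fx fx_min] := fP x; have [fy fy_min] := fP y.
  by rewrite fx_min ?fy_min // ?eq_xy // -eq_xy.
exists f.
  apply/block_minimaP; split=> x; last exact/f_block/block_f.
  exact: (fP x).2.
rewrite -[LHS](preim_partition_pblock partP).
apply: eq_imset => x; apply/setP => y; rewrite !inE.
apply/eqP/eqP => [/f_block//|eq_f].
by rewrite -block_f eq_f block_f.
Qed.

Lemma card_block_minima_partitions n : #|block_minima n| = Bell n.
Proof.
rewrite -(card_in_imset (@preim_block_minima_inj n)); apply: eq_card => P.
rewrite inE; apply/imsetP/idP => [[f _ ->]|/partition_block_minima//].
exact: preim_partitionP.
Qed.

(** * The reading order of a partition *)

(** The letters are read by decreasing [f x] and, within a block, the minimum
    first and then the other letters in decreasing order.  The second summand is
    at most n, so that the comparison of keys is lexicographic. *)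
Definition reading_key n (f : 'I_n -> 'I_n) (x : 'I_n) : nat :=
  (n - f x) * n.+1 + (if f x == x then 0 else n - x).

Lemma reading_key_lt n (f : 'I_n -> 'I_n) x y :
  reading_key f x < reading_key f y =
  (f y < f x) || (f x == f y) && (y != f y) && ((f x == x) || (y < x)).
Proof.
rewrite /reading_key.
have [xn yn] := (ltn_ord x, ltn_ord y).
have [fxn fyn] := (ltn_ord (f x), ltn_ord (f y)).
set a := (if f x == x then _ else _); set b := (if f y == y then _ else _).
have an : a <= n by rewrite /a; case: ifP => // _; rewrite leq_subr.
have bn : b <= n by rewrite /b; case: ifP => // _; rewrite leq_subr.
rewrite -[f x == f y]val_eqE /=.
case: (ltngtP (f y) (f x)) => [lt_f|lt_f|eq_f] /=.
- by nia.
- by nia.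
rewrite eq_f ltn_add2l /a /b (eq_sym y).
case: (f y =P y); case: (f x =P x) => /=; lia.
Qed.

Lemma reading_key_inj n (f : 'I_n -> 'I_n) : injective (reading_key f).
Proof.
move=> x y eq_key; apply/eqP; apply: contraT => /negPf neq_xy.
have := reading_key_lt f x y; have := reading_key_lt f y x.
rewrite eq_key ltnn -!val_eqE /= in neq_xy *; lia.
Qed.

(** * Prefix minima *)

(** Here [t] gives the position of each letter, so that it is the inverse of
    the permutation whose word is considered. *)
Definition prefix_min n (t : 'S_n) (x : 'I_n) : 'I_n :=
  [arg min_(y < x | t y <= t x) y].

Definition prefix_minima n (s : 'S_n) : {ffun 'I_n -> 'I_n} :=
  [ffun x => prefix_min s^-1 x].

Lemma prefix_minP n (t : 'S_n) x :
  t (prefix_min t x) <= t x /\ (forall y, t y <= t x -> prefix_min t x <= y).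
Proof. by rewrite /prefix_min; case: arg_minnP. Qed.

Lemma prefix_minima_block_minima n (s : 'S_n) :
  prefix_minima s \in block_minima n.
Proof.
apply/block_minimaP; split=> x; rewrite !ffunE; first by apply (prefix_minP _ x).2.
have [mx mx_min] := prefix_minP s^-1 x.
have [mmx mmx_min] := prefix_minP s^-1 (prefix_min s^-1 x).
apply/val_inj/anti_leq; rewrite mmx_min //=; apply: mx_min.
exact: leq_trans mx.
Qed.

(** Suppose that y < x have the same prefix minimum m, that y is not m and that
    y is to the left of x.  The first letter after y that exceeds y is at the
    latest x, and the letter before it exceeds m and is at most y: m and these
    two letters form an a-bc. *)
Lemma avoider_decreasing n (s : 'S_n) x y : avoids a_bc s ->
  prefix_min s^-1 x = prefix_min s^-1 y -> y != prefix_min s^-1 y -> y < x ->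
  (s^-1)%g x < (s^-1)%g y.
Proof.
move=> /avoids_a_bcP avs eq_m; set m := prefix_min _ y in eq_m *.
move=> neq_ym lt_yx; rewrite ltnNge; apply/negP => le_yx.
have [my _] := prefix_minP s^-1 y; have [_ mx_min] := prefix_minP s^-1 x.
rewrite -/m eq_m in my mx_min.
have lt_my : (s^-1)%g m < (s^-1)%g y.
  by rewrite ltn_neqAle my val_eqE (inj_eq perm_inj) eq_sym neq_ym.
have x_later : ((s^-1)%g y < (s^-1)%g x) && (y < s ((s^-1)%g x)).
  rewrite permKV lt_yx andbT ltn_neqAle le_yx val_eqE (inj_eq perm_inj).
  by rewrite -val_eqE ltn_eqF.
pose exceeds_after_y (k : 'I_n) := ((s^-1)%g y < k) && (y < s k).
case: (@arg_minnP _ _ exceeds_after_y val x_later) => k /andP[lt_yk lt_ysk] k_min.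
have le_kx := k_min _ x_later.
pose j := Ordinal (leq_ltn_trans (leq_pred k) (ltn_ord k)).
have kj : k = j.+1 :> nat by rewrite /= prednK //; apply: leq_ltn_trans lt_yk.
have le_yj : (s^-1)%g y <= j by rewrite -ltnS -kj.
have le_sjy : s j <= y.
  rewrite leqNgt; apply/negP => lt_ysj; move: le_yj; rewrite leq_eqVlt.
  case/orP => [/eqP/val_inj eq_yj | lt_yj].
    by move: lt_ysj; rewrite -eq_yj permKV ltnn.
  by have := k_min j; rewrite /exceeds_after_y lt_yj lt_ysj /= => /(_ isT); rewrite kj ltnn.
have lt_mj : (s^-1)%g m < j by apply: leq_trans le_yj.
apply: (avs _ _ _ lt_mj kj); last exact: leq_ltn_trans lt_ysk.
rewrite permKV ltn_neqAle mx_min ?permK; last by rewrite -ltnS -kj ltnW.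
rewrite andbT; apply: contraTneq lt_mj => /val_inj->.
by rewrite permK ltnn.
Qed.

(** The letters of an avoider are in the reading order of its prefix minima. As
    two total orders are compared, one implication is enough. *)
Lemma avoider_sorted n (s : 'S_n) x y : avoids a_bc s ->
  ((s^-1)%g x < (s^-1)%g y) =
  (reading_key (prefix_minima s) x < reading_key (prefix_minima s) y).
Proof.
move=> avs.
have sorted a b :
    reading_key (prefix_minima s) a < reading_key (prefix_minima s) b ->
    (s^-1)%g a < (s^-1)%g b.
  have [ma ma_min] := prefix_minP s^-1 a; have [mb mb_min] := prefix_minP s^-1 b.
  rewrite reading_key_lt !ffunE => /orP[lt_m|/andP[/andP[/eqP eq_m neq_b]]].
    rewrite ltnNge; apply: contraL lt_m => le_ba; rewrite -leqNgt.
    by apply: ma_min; apply: leq_trans le_ba.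
  case/orP => [/eqP eq_a|lt_ba]; last exact: avoider_decreasing.
  rewrite ltn_neqAle -{2}eq_a eq_m mb andbT.
  rewrite val_eqE (inj_eq perm_inj) -eq_a eq_m.
  by rewrite eq_sym.
apply/idP/idP => [|/sorted//]; rewrite !ltnNge; apply: contra.
by rewrite leq_eqVlt => /predU1P[/reading_key_inj-> // | /sorted/ltnW].
Qed.

Lemma prefix_minima_inj n : {in avoiders a_bc n &, injective (@prefix_minima n)}.
Proof.
move=> s u; rewrite !inE => avs avu eq_m; apply: invg_inj.
by apply: perm_eq_order => x y; rewrite !avoider_sorted // eq_m.
Qed.

(** Every letter weakly to the left of x has a block minimum at least f x, and
    f x itself is weakly to the left of x. *)
Lemma sorted_prefix_minima n (f : {ffun 'I_n -> 'I_n}) (s : 'S_n) :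
  f \in block_minima n ->
  (forall x y, ((s^-1)%g x < (s^-1)%g y) = (reading_key f x < reading_key f y)) ->
  prefix_minima s = f.
Proof.
move=> /block_minimaP[fle fK] sorted; apply/ffunP => x; rewrite ffunE.
have [mx mx_min] := prefix_minP s^-1 x.
apply/val_inj/anti_leq/andP; split.
  by apply: mx_min; rewrite leqNgt sorted reading_key_lt fK ltnn eqxx.
move: mx; set m := prefix_min _ x; rewrite leqNgt sorted reading_key_lt.
by move=> /norP[]; rewrite -leqNgt => /leq_trans-/(_ _ (fle m)).
Qed.

(** Let x, y, z form an a-bc.  If y and z were in the same block, y would be its
    minimum, since y < z; as x precedes y, this gives x >= f x >= f y = y.
    Otherwise f z < f y, so that f z is weakly between y and z in the word;
    hence it is z, and z = f z < f y <= y. *)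
Lemma sorted_avoids n (f : {ffun 'I_n -> 'I_n}) (s : 'S_n) :
  f \in block_minima n ->
  (forall x y, ((s^-1)%g x < (s^-1)%g y) = (reading_key f x < reading_key f y)) ->
  avoids a_bc s.
Proof.
move=> /block_minimaP[fle fK] sorted.
apply/avoids_a_bcP => i j k ij kj lt_xy lt_yz.
have key_xy : reading_key f (s i) < reading_key f (s j) by rewrite -sorted !permK.
have key_yz : reading_key f (s j) < reading_key f (s k).
  by rewrite -sorted !permK kj.
have le_f : f (s j) <= f (s i).
  by move: key_xy; rewrite reading_key_lt => /orP[/ltnW|/andP[/andP[/eqP->]]].
move: key_yz; rewrite reading_key_lt => /orP[lt_f|/andP[_ /orP[/eqP eq_y|]]].
- have lt_jw : j < (s^-1)%g (f (s k)).
    by have := sorted (s j) (f (s k)); rewrite permK reading_key_lt fK lt_f => ->.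
  have le_wk : (s^-1)%g (f (s k)) <= k.
    have := sorted (s k) (f (s k)).
    by rewrite permK reading_key_lt fK ltnn eqxx ltnNge => /negbFE.
  have eq_wk : (s^-1)%g (f (s k)) = k.
    by apply/val_inj/anti_leq; rewrite le_wk /= kj.
  have eq_z : f (s k) = s k by rewrite -[in RHS]eq_wk permKV.
  by have := fle (s j); rewrite leqNgt (ltn_trans lt_yz) // -eq_z.
- by have := leq_trans le_f (fle (s i)); rewrite eq_y leqNgt lt_xy.
- by rewrite ltnNge ltnW.
Qed.

Lemma card_avoiders_block_minima n : #|avoiders a_bc n| = #|block_minima n|.
Proof.
rewrite -(card_in_imset (@prefix_minima_inj n)); apply: eq_card => f.
apply/imsetP/idP => [[s _ ->]|fB]; first exact: prefix_minima_block_minima.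
have [t sorted] := perm_of_key (@reading_key_inj n f).
rewrite -(invgK t) in sorted.
exists t^-1%g; last by rewrite (sorted_prefix_minima fB sorted).
by rewrite inE (sorted_avoids fB sorted).
Qed.

Theorem proposition2 (n : nat) :
  (exists f : {P : {set {set 'I_n}} | P \in set_partitions n} ->
              {s : 'S_n | s \in avoiders a_bc n}, bijective f)
  /\ #|avoiders a_bc n| = Bell n.
Proof.
have card_eq : #|avoiders a_bc n| = Bell n.
  by rewrite card_avoiders_block_minima card_block_minima_partitions.
split=> //.
have card_sig : #|{: {P : {set {set 'I_n}} | P \in set_partitions n}}| =
                #|{: {s : 'S_n | s \in avoiders a_bc n}}|.
  by rewrite !card_sig; rewrite -[LHS]/(Bell n) -card_eq; apply: eq_card.
exists (fun P => enum_val (cast_ord card_sig (enum_rank P))).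
exists (fun s => enum_val (cast_ord (esym card_sig) (enum_rank s))) => x.
  by rewrite enum_valK cast_ordK enum_rankK.
by rewrite enum_valK cast_ordKV enum_rankK.
Qed.
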